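(* Let $m \equiv 3 \pmod 4$ and $n \equiv 1 \pmod 4$ be two distinct square-free positive integers, and let $K = \mathbb{Q}(\sqrt{-m},\sqrt{n})$. Then $$ g(\mathcal{O}_K) \leq \begin{cases} s(\mathcal{O}_K)+1 & \text{if } s(\mathcal{O}_K) \text{ is even},\\ s(\mathcal{O}_K)+2 & \text{if } s(\mathcal{O}_K) \text{ is odd}.\end{cases} $$
   Context: For a number field $K$, $\mathcal{O}_K$ denotes its ring of integers. $s(\mathcal{O}_K)$ is the minimal number of squares required to represent $-1$ in $\mathcal{O}_K$, i.e. the smallest positive integer $s$ such that $-1$ is a sum of $s$ squares of elements of $\mathcal{O}_K$. $g(\mathcal{O}_K)$ is the smallest positive integer $t$ such that every element of $\mathcal{O}_K$ is a sum of $t$ squares of elements of $\mathcal{O}_K$ (zero summands allowed); the asserted inequality includes the existence of such a $t$. *)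

(* Defs.v *)
From HB Require Import structures.
From mathcomp Require Import all_boot all_order all_algebra all_fingroup all_field.

Set Implicit Arguments.
Unset Strict Implicit.
Unset Printing Implicit Defensive.

Import Order.TTheory GRing.Theory Num.Theory.
Local Open Scope ring_scope.

Definition square_free (n : nat) : Prop :=
  forall d : nat, (d ^ 2 %| n)%N -> d = 1%N.

Section SumsOfSquares.

Variable K : fieldExtType rat.

(* Membership in O_K, the integral closure of Z in K. *)
Definition ring_of_integers (x : K) : Prop :=
  integralOver (fun z : int => z%:~R : K) x.

(* Some of the k summands may be zero. *)
Definition sum_of_squares (k : nat) (x : K) : Prop :=
  exists f : 'I_k -> K,
    (forall i, ring_of_integers (f i)) /\ x = \sum_(i < k) f i ^+ 2.

End SumsOfSquares.

Definition least_positive (P : nat -> Prop) (k : nat) : Prop :=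
  [/\ (0 < k)%N, P k & forall j : nat, (0 < j)%N -> P j -> (k <= j)%N].

(* s(O_K) and g(O_K) are given as relations, so that "level_is K s" also
   asserts that the minimum exists; it is unique by least_positive_unique. *)
Definition level_is (K : fieldExtType rat) (s : nat) : Prop :=
  least_positive (fun k => sum_of_squares k (-1 : K)) s.

Definition g_invariant_is (K : fieldExtType rat) (g : nat) : Prop :=
  least_positive
    (fun k => forall x : K, ring_of_integers x -> sum_of_squares k x) g.

(* K = Q(sqrt(-m), sqrt n): generated over Q by a square root a of -m and a
   square root b of n (the choice of roots is immaterial). *)
Definition is_Q_sqrt_sqrt (m n : nat) (K : fieldExtType rat) : Prop :=
  exists a b : K,
    [/\ a ^+ 2 = - m%:R, b ^+ 2 = n%:R & <<1 & [:: a; b]>>%VS = fullv].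

Lemma least_positive_unique (P : nat -> Prop) (j k : nat) :
  least_positive P j -> least_positive P k -> j = k.
Proof.
move=> [j0 Pj minj] [k0 Pk mink].
by apply/eqP; rewrite eqn_leq minj // mink.
Qed.

Lemma Q_sqrt_sqrt_exists (m n : nat) :
  exists K : fieldExtType rat, is_Q_sqrt_sqrt m n K.
Proof.
have [K [KtoC [s Ds genK]]] := num_field_exists [:: sqrtC (- m%:R); sqrtC n%:R].
case: s Ds genK => [|a [|b [|? ?]]] //= [Da Db] genK.
exists K, a, b; split=> //; apply: (fmorph_inj KtoC).
  by rewrite rmorphXn /= Da sqrtCK rmorphN rmorph_nat.
by rewrite rmorphXn /= Db sqrtCK rmorph_nat.
Qed.

(* Main.v *)
Require Import Defs.
From mathcomp Require Import all_boot all_order all_algebra all_fingroup all_field.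
From mathcomp Require Import ring zify.
From Stdlib Require Import Classical.

(* If -1 = \sum_i e_i^2 with s terms, then (1, e_1, .., e_s) is an isotropic
   vector of the unit form in s+1 variables, and translating along it reaches
   every x whose residue modulo 2 is attained by suitable vectors; for s even
   this only requires x to be a square modulo 2, and for s odd one first adds
   a zero term to the representation of -1.  Every element of O_K is a square
   modulo 2 because O_K / 2 is perfect: the order Z[(1+a)/2, (1+b)/2], with
   a^2 = -m and b^2 = n, is reduced modulo 2, hence of odd index in O_K. *)

Lemma least_positive_exists (P : nat -> Prop) (k : nat) :
  (0 < k)%N -> P k -> exists j, least_positive P j.
Proof.
have [n] := ubnP k; elim: n k => // n IHn k lt_k_n k_gt0 Pk.
have [[j [j_gt0 Pj lt_j_k]] | kmin] :=
  classic (exists j, [/\ (0 < j)%N, P j & (j < k)%N]).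
  by apply: (IHn j) => //; apply: leq_trans lt_j_k _.
exists k; split=> // j j_gt0 Pj; rewrite leqNgt; apply/negP => lt_j_k.
by apply: kmin; exists j.
Qed.

(** * Integers of [K] and sums of squares *)

Section RingOfIntegers.

Set Implicit Arguments.
Unset Strict Implicit.
Unset Printing Implicit Defensive.
Import Order.TTheory GRing.Theory Num.Theory.
Local Open Scope ring_scope.

Variable K : fieldExtType rat.

Notation O := (@ring_of_integers K).

Lemma natr_neq0 (n : nat) : (0 < n)%N -> n%:R != 0 :> K.
Proof.
move=> n_gt0; have := fmorph_eq0 (in_alg K) n%:R.
by rewrite rmorph_nat => ->; rewrite pnatr_eq0 -lt0n.
Qed.

Lemma two_neq0 : 2 != 0 :> K.
Proof. exact: (@natr_neq0 2). Qed.

Lemma integers_int (z : int) : O z%:~R.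
Proof. exact: (integral_id (intr : {rmorphism int -> K})). Qed.

Lemma integers_nat (n : nat) : O n%:R.
Proof. exact: (integral_nat (intr : {rmorphism int -> K})). Qed.

Lemma integers_add (x y : K) : O x -> O y -> O (x + y).
Proof. exact: (@integral_add _ _ (intr : {rmorphism int -> K})). Qed.

Lemma integers_mul (x y : K) : O x -> O y -> O (x * y).
Proof. exact: (@integral_mul _ _ (intr : {rmorphism int -> K})). Qed.

Lemma integers_opp (x : K) : O x -> O (- x).
Proof. exact: (@integral_opp _ _ (intr : {rmorphism int -> K})). Qed.

Lemma integers_exp (x : K) (n : nat) : O x -> O (x ^+ n).
Proof.
move=> Ox; elim: n => [|n IHn]; first exact: (integers_nat 1).
by rewrite exprS; apply: integers_mul.
Qed.

Lemma integers_sum (I : finType) (f : I -> K) :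
  (forall i, O (f i)) -> O (\sum_i f i).
Proof.
move=> Of; elim/big_ind: _ => //; first exact: (integers_nat 0).
exact: integers_add.
Qed.

Lemma integers_root (p : {poly int}) (x : K) :
  p \is monic -> (map_poly intr p).[x] = 0 -> O x.
Proof. by move=> p_mon px0; exists p => //; apply/rootP. Qed.

Ltac integers := repeat match goal with
  | |- O (_ + _) => apply: integers_add
  | |- O (_ * _) => apply: integers_mul
  | |- O (- _) => apply: integers_opp
  | |- O (_ ^+ _) => apply: integers_exp
  | |- O 1 => exact: (integers_nat 1)
  | |- O 0 => exact: (integers_nat 0)
  | |- O _%:R => exact: integers_nat
  | |- O _%:~R => exact: integers_int
  | |- _ => assumption
  end.

Lemma sum_of_squaresW (k : nat) (x : K) :
  sum_of_squares k x -> sum_of_squares k.+1 x.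
Proof.
case=> f [Of ->]; exists (fun i => oapp f 0 (unlift ord0 i)); split=> [i|].
  by case: unliftP => [j|] _ //=; integers.
rewrite big_ord_recl unlift_none /= expr0n add0r.
by apply: eq_bigr => i _; rewrite liftK.
Qed.

Lemma sum_sqr_mod2 (k : nat) (f : 'I_k -> K) :
  (forall i, O (f i)) ->
  exists2 r, O r & (\sum_i f i) ^+ 2 = \sum_i f i ^+ 2 + 2 * r.
Proof.
elim: k f => [|k IHk] f Of.
  by exists 0; [integers | rewrite !big_ord0 mulr0 expr0n addr0].
have [r Or sumf] := IHk (fun i => f (lift ord0 i)) (fun i => Of _).
exists (r + f ord0 * \sum_i f (lift ord0 i));
  first by integers=> //; apply: integers_sum.
rewrite !big_ord_recl sqrrD sumf; ring.
Qed.

(* In the unit form in k+1 variables, v = (1, e_i) is isotropic, so moving w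
   along v changes the value at w by 2 t B(w, v).  For k even there is, for
   every h, a w with B(w, v) = 1 whose value is congruent to (1 + h)^2 mod 2,
   namely w = (1 - h (1 + \sum_i e_i), h (1 - e_i)). *)
Lemma sum_of_squares_even_level (k : nat) (x y z : K) :
  ~~ odd k -> sum_of_squares k (-1 : K) -> O y -> O z ->
  x = y ^+ 2 + 2 * z -> sum_of_squares k.+1 x.
Proof.
move=> k_even [e [Oe sum_e]] Oy Oz ->.
have [r Or] := sum_sqr_mod2 Oe; rewrite -sum_e; set S := \sum_i e i => sqrS.
have OS : O S by apply: integers_sum.
have defk : k%:R = 2 * k./2%:R :> K.
  by rewrite -[in LHS](even_halfK k_even) -muln2 natrM mulrC.
pose h := y - 1; have Oh : O h by rewrite /h; integers.
(* With [w] as above, its value is [1 - 2h(S + 1) + h^2 (S^2 + k)], where [S^2 = -1 + 2r]. This [t]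
   solves value of [w] plus [2t] equal to [y^2 + 2z]; it is integral because [k] is even. *)
pose t := z + h + h ^+ 2 + h * (S + 1) - h ^+ 2 * (r + k./2%:R).
have Ot : O t by rewrite /t; integers.
exists (fun i => oapp (fun j => h * (1 - e j) + t * e j)
                      (1 - h * (S + 1) + t) (unlift ord0 i)); split=> [i|].
  by case: unliftP => [j|] _ /=; integers.
rewrite big_ord_recl unlift_none /=.
under eq_bigr do rewrite liftK /=.
have -> : \sum_(i < k) (h * (1 - e i) + t * e i) ^+ 2
   = h ^+ 2 * k%:R + 2 * h * (t - h) * S + (t - h) ^+ 2 * (-1).
  rewrite sum_e /S !mulr_sumr -[k in k%:R]card_ord -sum1_card natr_sum.
  by rewrite mulr_sumr -!big_split; apply: eq_bigr => i _ /=; ring.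
rewrite defk; have -> : y = h + 1 by rewrite subrK.
have -> : z = t - h - h ^+ 2 - h * (S + 1) + h ^+ 2 * (r + k./2%:R).
  by rewrite /t; ring.
have -> : r = (S ^+ 2 + 1) / 2 by rewrite sqrS; field; exact: two_neq0.
by field; exact: two_neq0.
Qed.

(** * The order generated by two quadratic integers, modulo 2 *)

Section QuadraticGenerators.

Variables (alpha beta : K) (c d : int).
Hypothesis alpha_eq : alpha ^+ 2 = alpha + c%:~R.
Hypothesis beta_eq : beta ^+ 2 = beta + d%:~R.

(** The order Z[[alpha], [beta]], given inductively so that congruences modulo 2 can be proved by
    induction on the ring operations. *)
Inductive generated : K -> Prop :=
| Gen_int (z : int) : generated z%:~R
| Gen_alpha : generated alpha
| Gen_beta : generated beta
| Gen_add (u v : K) : generated u -> generated v -> generated (u + v)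
| Gen_mul (u v : K) : generated u -> generated v -> generated (u * v).

Notation R := generated.

Lemma generated_nat (n : nat) : R n%:R.
Proof. exact: (Gen_int n). Qed.

Lemma generated_opp (u : K) : R u -> R (- u).
Proof. by rewrite -mulN1r; apply: Gen_mul; exact: (Gen_int (-1)). Qed.

Lemma generated_exp (u : K) (n : nat) : R u -> R (u ^+ n).
Proof.
move=> Ru; elim: n => [|n IHn]; first exact: (generated_nat 1).
by rewrite exprS; apply: Gen_mul.
Qed.

Ltac generated := repeat match goal with
  | |- R (_ + _) => apply: Gen_add
  | |- R (_ * _) => apply: Gen_mul
  | |- R (- _) => apply: generated_opp
  | |- R (_ ^+ _) => apply: generated_exp
  | |- R 1 => exact: (generated_nat 1)
  | |- R 0 => exact: (generated_nat 0)
  | |- R _%:R => exact: generated_nat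
  | |- R _%:~R => exact: Gen_int
  | |- R alpha => exact: Gen_alpha
  | |- R beta => exact: Gen_beta
  | |- _ => assumption
  end.

Lemma integers_quadratic (x : K) (z : int) : x ^+ 2 = x + z%:~R -> O x.
Proof.
move=> x2; apply: (@integers_root ('X^2 - ('X + z%:P))).
  rewrite monicE lead_coefDl ?lead_coefXn // size_polyXn size_polyN.
  by rewrite size_XaddC.
by rewrite !(rmorphB, rmorphD) /= map_polyXn map_polyX map_polyC
  !hornerE x2 subrr.
Qed.

Lemma generated_integers (u : K) : R u -> O u.
Proof.
elim=> [z|||u1 v1 _ Ou _ Ov|u1 v1 _ Ou _ Ov]; [by integers| | |by integers..].
- exact: integers_quadratic alpha_eq.
- exact: integers_quadratic beta_eq.
Qed.

Lemma int_parity (z : int) : exists (q : int) (b : bool), z = 2 * q + b%:R.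
Proof.
exists (z %/ 2)%Z, ((z %% 2)%Z == 1); lia.
Qed.

Lemma frobenius2_quadratic (x : K) (z : int) :
  R x -> x ^+ 2 = x + z%:~R -> exists2 v, R v & x ^+ 4 = x + 2 * v.
Proof.
move=> Rx x2; have [q [b defz]] := int_parity z.
(* The integer summand is [z(z + 1)/2], written through [q] and [b] to avoid the division. *)
exists (z%:~R * x + (q * (2 * q + 1) + b%:R * (2 * q + 1))%:~R);
  first by generated.
rewrite (exprM x 2 2) x2 sqrrD x2 defz; case: b {defz} => /=; ring.
Qed.

(** Modulo 2 the fourth power map is a ring endomorphism fixing the generators, because
    [X^2 - X - c] and [X^2 - X - d] split over the field with 4 elements. This makes R/2R both
    reduced and perfect. *)
Lemma frobenius2_mod2 (u : K) : R u -> exists2 v, R v & u ^+ 4 = u + 2 * v.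
Proof.
elim=> {u} [z|||u v Ru [u' Ru' Eu] Rv [v' Rv' Ev]
           |u v Ru [u' Ru' Eu] Rv [v' Rv' Ev]].
- have [q [[] ->]] := int_parity z.
    exists (8 * q ^+ 4 + 16 * q ^+ 3 + 12 * q ^+ 2 + 3 * q)%:~R;
      first by generated.
    by rewrite /=; ring.
  exists (8 * q ^+ 4 - q)%:~R; first by generated.
  by rewrite /=; ring.
- exact: frobenius2_quadratic Gen_alpha alpha_eq.
- exact: frobenius2_quadratic Gen_beta beta_eq.
- exists (u' + v' + 2 * u ^+ 3 * v + 3 * u ^+ 2 * v ^+ 2 + 2 * u * v ^+ 3);
    first by generated.
  have -> : (u + v) ^+ 4 = u ^+ 4 + v ^+ 4
     + 2 * (2 * u ^+ 3 * v + 3 * u ^+ 2 * v ^+ 2 + 2 * u * v ^+ 3) by ring.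
  by rewrite Eu Ev; ring.
- exists (u * v' + u' * v + 2 * u' * v'); first by generated.
  by rewrite exprMn Eu Ev; ring.
Qed.

(** Reducedness of R/2R: iterating the congruence gives [u = u ^+ (4 ^ k)] modulo 2, and
    [k <= 4 ^ k]. *)
Lemma half_generated_expn (u : K) (k : nat) :
  R u -> R (u ^+ k / 2) -> R (u / 2).
Proof.
move=> Ru Rk.
suff [v Rv Ev] : exists2 v, R v & u ^+ (4 ^ k) = u + 2 * v.
  have -> : u / 2 = u ^+ (4 ^ k - k) * (u ^+ k / 2) - v.
    rewrite mulrA -exprD subnK ?Ev; first by field; exact: two_neq0.
    by apply/ltnW/ltn_expl.
  exact: Gen_add (Gen_mul (generated_exp _ Ru) Rk) (generated_opp Rv).
elim: {Rk}k => [|k [v Rv Ev]];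
  first by exists 0; [generated | rewrite mulr0 addr0].
have [w Rw Ew] := frobenius2_mod2 (generated_exp (4 ^ k) Ru).
exists (v + w); first by generated.
by rewrite expnSr exprM Ew Ev; ring.
Qed.

(** Multiplying a monic integral equation of degree [k] for [u / 2] by [2 ^+ k] shows that [u ^+ k]
    lies in 2R; reducedness then puts [u] itself in 2R. *)
Lemma half_generated (u : K) : R u -> O (u / 2) -> R (u / 2).
Proof.
move=> Ru [p p_mon /rootP]; have p_gt0 : (0 < size p)%N.
  by rewrite size_poly_gt0 monic_neq0.
rewrite horner_coef size_map_poly_id0; last first.
  by rewrite (monicP p_mon) rmorph1 oner_neq0.
rewrite -(prednK p_gt0) big_ord_recr /= => /eqP.
rewrite coef_map /= -[p`__]/(lead_coef p) (monicP p_mon) mul1r addrC addr_eq0.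
set k := (size p).-1 => /eqP pu0; apply: (@half_generated_expn _ k) => //.
have -> : u ^+ k / 2 = 2 ^+ k / 2 * (u / 2) ^+ k.
  by rewrite expr_div_n; field; rewrite expf_neq0 two_neq0.
rewrite pu0 mulrN mulr_sumr; apply/generated_opp.
elim/big_ind: _ => [||i _]; [by generated | exact: Gen_add |].
have -> : 2 ^+ k / 2 * ((map_poly intr p)`_i * (u / 2) ^+ i)
    = 2 ^+ (k - i.+1) * ((p`_i)%:~R * u ^+ i) :> K.
  rewrite coef_map /= expr_div_n -{1}(subnK (ltn_ord i)) exprD exprS.
  by field; rewrite expf_neq0 two_neq0.
by generated.
Qed.

(** * Denominators relative to the order *)

Lemma odd_denominator (N : nat) (x : K) :
  (0 < N)%N -> O x -> R (N%:R * x) -> exists2 D, odd D & R (D%:R * x).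
Proof.
move=> + Ox; have [n] := ubnP N; elim: n N => // n IHn N lt_N_n N_gt0 RNx.
have [N_odd | N_even] := boolP (odd N); first by exists N.
have half_Nx : N%:R * x / 2 = N./2%:R * x.
  rewrite -{1}(even_halfK N_even) -muln2 natrM.
  by field; exact: two_neq0.
(* Half of [N * x] is [N./2 * x], still integral, so an even denominator can always be halved. *)
apply: (IHn N./2); [lia | lia |].
rewrite -half_Nx; apply: half_generated; rewrite ?half_Nx //.
by integers.
Qed.

(** Membership in the Q-span of the order, which is all of [K] once [alpha] and [beta] generate [K]
    over Q. *)
Definition has_denominator (x : K) : Prop :=
  exists2 N, (0 < N)%N & R (N%:R * x).

Lemma has_denominator_add (x y : K) :
  has_denominator x -> has_denominator y -> has_denominator (x + y).
Proof.
move=> [N N_gt0 RNx] [M M_gt0 RMy]; exists (N * M)%N;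
  first by rewrite muln_gt0 N_gt0.
have -> : (N * M)%:R * (x + y) = M%:R * (N%:R * x) + N%:R * (M%:R * y) by ring.
exact: Gen_add (Gen_mul (generated_nat _) RNx) (Gen_mul (generated_nat _) RMy).
Qed.

Lemma has_denominator_mul (x y : K) :
  has_denominator x -> has_denominator y -> has_denominator (x * y).
Proof.
move=> [N N_gt0 RNx] [M M_gt0 RMy]; exists (N * M)%N;
  first by rewrite muln_gt0 N_gt0.
by rewrite natrM mulrACA; apply: Gen_mul.
Qed.

Lemma has_denominator_generated (x : K) : R x -> has_denominator x.
Proof. by move=> Rx; exists 1%N; rewrite // mul1r. Qed.

Lemma has_denominator_rat (r : rat) : has_denominator r%:A.
Proof.
exists `|denq r|%N; first by rewrite absz_gt0 denq_neq0.
suff -> : `|denq r|%:R * r%:A = (numq r)%:~R :> K by generated.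
rewrite -(rmorph_nat (in_alg K)) -(rmorph_int (in_alg K)) -[r%:A]/(in_alg K r).
by rewrite -rmorphM numqE mulrC -[in RHS](gez0_abs (ltW (denq_gt0 r))).
Qed.

Lemma has_denominator_adjoin (E : {subfield K}) (g : K) :
  has_denominator g -> {in E, forall x, has_denominator x} ->
  {in <<E; g>>%VS, forall x, has_denominator x}.
Proof.
move=> Rg RE _ /Fadjoin_polyP[p /polyOverP pE ->]; rewrite horner_coef.
elim/big_ind: _ => [||i _];
  first by apply: has_denominator_generated; generated.
  exact: has_denominator_add.
apply: has_denominator_mul; first exact: RE.
elim: (i : nat) => [|j IHj];
  first exact: has_denominator_generated (generated_nat 1).
by rewrite exprS; apply: has_denominator_mul.
Qed.

Lemma integers_sqr_mod2 (x : K) :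
  <<1 & [:: 2 * alpha - 1; 2 * beta - 1]>>%VS = fullv -> O x ->
  exists y z, [/\ O y, O z & x = y ^+ 2 + 2 * z].
Proof.
move=> genK Ox; have [N N_gt0 RNx] : has_denominator x.
  have : x \in <<1 & [:: 2 * alpha - 1; 2 * beta - 1]>>%VS.
    by rewrite genK memvf.
  rewrite !(adjoin_cons, adjoin_nil) subfield_closed.
  apply: has_denominator_adjoin;
    first by apply: has_denominator_generated; generated.
  apply: has_denominator_adjoin;
    first by apply: has_denominator_generated; generated.
  by move=> _ /vlineP[r ->]; exact: has_denominator_rat.
have [D D_odd RDx] := odd_denominator N_gt0 Ox RNx.
have [v /generated_integers Ov Ev] := frobenius2_mod2 RDx.
(* Modulo 2, [x] agrees with [D * x] since [D] is odd, and [D * x] agrees with its fourth power, the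
   square of [(D * x) ^+ 2]. *)
exists ((D%:R * x) ^+ 2), (- v - D./2%:R * x); split; [by integers.. |].
have defD : D%:R = 1 + 2 * D./2%:R :> K.
  by rewrite -[in LHS](odd_double_half D) D_odd -mul2n natrD natrM.
by rewrite -exprM Ev defD; ring.
Qed.

End QuadraticGenerators.

Lemma integers_sqr_mod2_biquadratic (m n : nat) (a b x : K) :
  m = 3 %[mod 4] -> n = 1 %[mod 4] ->
  a ^+ 2 = - m%:R -> b ^+ 2 = n%:R -> <<1 & [:: a; b]>>%VS = fullv ->
  O x -> exists y z, [/\ O y, O z & x = y ^+ 2 + 2 * z].
Proof.
move=> m_mod4 n_mod4 a2 b2 genK.
have [k defm] : exists k, m = (4 * k + 3)%N by exists (m %/ 4)%N; lia.
have [l defn] : exists l, n = (4 * l + 1)%N by exists (n %/ 4)%N; lia.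
have dblK (c : K) : 2 * ((1 + c) / 2) - 1 = c by field; exact: two_neq0.
(* The congruences modulo 4 make the constants [-(m + 1)/4] and [(n - 1)/4] integers. *)
apply: (@integers_sqr_mod2 ((1 + a) / 2) ((1 + b) / 2) (- k.+1%:Z) l).
- rewrite expr_div_n sqrrD a2 defm; field; by rewrite !natr_neq0.
- rewrite expr_div_n sqrrD b2 defn; field; by rewrite !natr_neq0.
- by rewrite !dblK.
Qed.

(** From [-1 = a^2 + (m - 1) * 1^2]; it guarantees that the level exists. *)
Lemma sum_of_squares_opp1 (m : nat) (a : K) :
  (0 < m)%N -> a ^+ 2 = - m%:R -> sum_of_squares m (-1 : K).
Proof.
case: m => // m _ a2; exists (fun i => oapp (fun=> 1) a (unlift ord0 i)).
split=> [i|].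
  case: unliftP => [j|] _ /=; first by integers.
  apply: (@integers_root ('X^2 + m.+1%:R%:P)).
    rewrite monicE lead_coefDl ?lead_coefXn // size_polyXn.
    exact: leq_ltn_trans (size_polyC_leq1 _) _.
  rewrite rmorphD /= map_polyXn map_polyC !hornerE a2 /= rmorph_nat addNr //.
rewrite big_ord_recl unlift_none /= a2.
under eq_bigr do rewrite liftK /= expr1n.
by rewrite sumr_const card_ord; ring.
Qed.

End RingOfIntegers.

Theorem theorem1p2 (m n : nat) (K : fieldExtType rat)
  (m_gt0 : (0 < m)%N) (n_gt0 : (0 < n)%N) (m_neq_n : m <> n)
  (m_sqfree : square_free m) (n_sqfree : square_free n)
  (m_mod4 : m = 3 %[mod 4]) (n_mod4 : n = 1 %[mod 4])
  (defK : is_Q_sqrt_sqrt m n K) :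
  exists s g : nat,
    [/\ level_is K s, g_invariant_is K g
      & (g <= if odd s then s + 2 else s + 1)%N].
Proof.
have [a [b [a2 b2 genK]]] := defK.
have [s level_s] : exists s, level_is K s.
  exact: least_positive_exists (sum_of_squares_opp1 m_gt0 a2).
have [s_gt0 opp1_s _] := level_s.
have sqr_mod2 := integers_sqr_mod2_biquadratic m_mod4 n_mod4 a2 b2 genK.
(* [t.-1] is whichever of [s] and [s + 1] is even, so -1 is a sum of an even number [t.-1] of
   squares. *)
pose t := if odd s then (s + 2)%N else (s + 1)%N.
have t_gt0 : (0 < t)%N by rewrite /t; case: odd; rewrite ?addn1 ?addn2.
have opp1_t : sum_of_squares t.-1 (-1 : K)%R.
  rewrite /t; case: odd; rewrite ?addn2 ?addn1 //.
  exact: sum_of_squaresW.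
have squares_t (x : K) : ring_of_integers x -> sum_of_squares t x.
  move=> /sqr_mod2[y [z [Oy Oz ->]]]; rewrite -(prednK t_gt0).
  apply: (sum_of_squares_even_level _ opp1_t Oy Oz) => //.
  by rewrite /t; case: ifP; lia.
have [g g_inv] : exists g, g_invariant_is K g.
  exact: least_positive_exists t_gt0 squares_t.
by exists s, g; split=> //; case: g_inv => _ _; apply.
Qed.
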